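(* For all integers $s,s'\ge0$ and all integers $n,m$ with $s+s'\ge n\ge m\ge0$, the following $q$-binomial identity holds: $$\sum_{j\in\mathbb Z}\sum_{i\in\mathbb Z}q^{2mi+j(2n-s-s')+ms}\begin{bmatrix} n-i \\ j \end{bmatrix}\begin{bmatrix} i \\ m-j \end{bmatrix}\begin{bmatrix} i+j+s-n \\ j \end{bmatrix}\begin{bmatrix} m-i-j+s' \\ m-j \end{bmatrix} =q^{2mn}\sum_{\ell=0}^{\min(s,s')}\begin{bmatrix} n-\ell \\ m \end{bmatrix}\begin{bmatrix} m+s+s'-\ell-n \\ m \end{bmatrix}.$$
   Context: Here $q$ is an indeterminate, $[n]=\frac{q^n-q^{-n}}{q-q^{-1}}$, $[n]!=[1][2]\cdots[n]$ for $n\ge1$, $[0]!=1$, and for $m,n\in\mathbb Z$ the symmetric $q$-binomial coefficient is $$\begin{bmatrix} m \\ n \end{bmatrix}=\begin{cases}0,&n<0\ \text{or}\ m-n<0,\\ \dfrac{[m]!}{[n]!\,[m-n]!},&\text{otherwise}\end{cases}$$ (a Laurent polynomial in $q$). *)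

(* Defs.v *)
From mathcomp Require Import all_boot all_order all_algebra.
From mathcomp Require Import classical_sets fsbigop.

Set Implicit Arguments.
Unset Strict Implicit.
Unset Printing Implicit Defensive.

Import Order.TTheory GRing.Theory Num.Theory.
Local Open Scope ring_scope.

(* The Laurent polynomials in the indeterminate q are viewed inside Q(q). *)
Definition qvar : {fraction {poly rat}} := FracField.tofrac 'X.

Definition qint (F : fieldType) (q : F) (n : int) : F :=
  (q ^ n - q ^ (- n)) / (q - q^-1).

Definition qfact (F : fieldType) (q : F) (n : nat) : F :=
  \prod_(1 <= k < n.+1) qint q k%:Z.

(* In the second branch 0 <= n <= m, so the absolute values only cast
   nonnegative integers to nat. *)
Definition qbinom (F : fieldType) (q : F) (m n : int) : F :=
  if (n < 0) || (m - n < 0) then 0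
  else qfact q `|m|%N / (qfact q `|n|%N * qfact q `|m - n|%N).

(* Main.v *)
Require Import Defs.
From mathcomp Require Import all_boot all_order all_algebra.
From mathcomp Require Import classical_sets fsbigop.
From mathcomp Require Import zify ring.

Import Order.TTheory GRing.Theory Num.Theory.
Local Open Scope classical_set_scope.
Local Open Scope ring_scope.

(** Both sides compute the trace of F^(m) E^(m) on the n-th weight space of the
    tensor product of the U_q(sl2)-modules V_s and V_s': the left-hand side in
    the product basis, via the coproduct, the right-hand side in a basis
    adapted to the Clebsch-Gordan decomposition into the V_(s+s'-2l).  The
    decomposition itself is not needed.  Write T(m, r) for the trace with
    n = m + r.  Cyclicity of the trace and the relation
    [E, F^(m+1)] = [H - m] F^(m) give
      [m+1] (T(m+1, r) - T(m+1, r-1)) = [s + s' - 2r - m] T(m, r);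
    the right-hand side satisfies the same recursion, and for m = 0 both sides
    are the dimension of the weight space. *)

(** * Reindexing of sums *)

(** Bridge from sums over sets of integers to iterated sums over naturals; [h] will be [Posz] or the
    reflection sending a to n - j - a. *)
Lemma fsum_int_nat (V : zmodType) (D : set int) (f : int -> V) (h : nat -> int)
    (N : nat) :
  injective h -> (forall a, (a < N)%N -> D (h a)) ->
  (forall x, D x -> (forall a, (a < N)%N -> x <> h a) -> f x = 0) ->
  \sum_(x \in D) f x = \sum_(0 <= a < N) f (h a).
Proof.
move=> h_inj hD f0.
have hr x : (x \in map h (index_iota 0 N)) -> exists2 a, (a < N)%N & x = h a.
  by case/mapP => a; rewrite mem_index_iota => /andP[_ aN] ->; exists a.
rewrite -[RHS](big_map h predT f) (@fsbigE _ _ _ _ _ (map h (index_iota 0 N))).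
- rewrite big_mkcond; apply: eq_big_seq => x /hr[a aN ->].
  by rewrite mem_set //; apply: hD.
- by rewrite map_inj_uniq ?iota_uniq.
- by move=> x /= /hr[a aN ->]; apply: hD.
- move=> x Dx xr; apply: f0 => // a aN xa.
  by case/negP: xr; rewrite xa map_f // mem_index_iota.
Qed.

(** Used when E^(m+1) is split by one factor E: [f] collects the terms where E hits the left tensor
    factor, [g] the right one. *)
Lemma big_antidiag_shift (V : nmodType) (f g : nat -> nat -> V) (m : nat) :
  f 0%N m.+1 = 0 -> g m.+1 0%N = 0 ->
  \sum_(0 <= j < m.+2) (f j (m.+1 - j)%N + g j (m.+1 - j)%N) =
  \sum_(0 <= j < m.+1) (f j.+1 (m - j)%N + g j (m - j).+1).
Proof.
move=> f0 g0; rewrite !big_split /=; congr (_ + _).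
  by rewrite big_nat_recl // subn0 f0 add0r.
rewrite big_nat_recr //= subnn g0 addr0.
by apply: eq_big_nat => j /andP[_ jm]; rewrite subSn.
Qed.

(** * Arithmetic of q-integers and q-binomials *)

Section QIdentities.

Variables (F : fieldType) (q : F).
Hypothesis qint_neq0 : forall k : nat, qint q k.+1%:Z != 0.

(** Since division by 0 gives 0, [1] would vanish if q = q^-1. As 0^-1 = 0, this also excludes q =
    0. *)
Lemma qsubV_neq0 : q - q^-1 != 0.
Proof.
by have := qint_neq0 0; apply: contraNneq => h; rewrite /qint h invr0 mulr0.
Qed.

Lemma q_neq0 : q != 0.
Proof.
by have := qsubV_neq0; apply: contraNneq => ->; rewrite invr0 subrr.
Qed.

Lemma qint0 : qint q 0 = 0.
Proof. by rewrite /qint oppr0 subrr mul0r. Qed.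

Lemma qintD (x y : int) :
  qint q (x + y) = q ^ (- y) * qint q x + q ^ x * qint q y.
Proof.
have q0 := q_neq0.
rewrite /qint opprD !expfzDr // !mulrA -mulrDl; congr (_ / _); ring.
Qed.

(** The q-analogue of (x + z) y - x (y + z) = z (y - x); both recursions rest on it. *)
Lemma qint_mulB (x y z : int) :
  qint q (x + z) * qint q y - qint q x * qint q (y + z) =
  qint q z * qint q (y - x).
Proof.
have q0 := q_neq0.
rewrite /qint; set d := (q - q^-1)^-1.
have -> (u v u' v' : F) : u * d * (v * d) - u' * d * (v' * d) =
  (u * v - u' * v') * d * d by ring.
rewrite [RHS]mulrACA [RHS]mulrA; congr (_ * _ * _).
rewrite !opprD !opprK !expfzDr // -!invr_expz.
have := expfz_neq0 x q0; have := expfz_neq0 y q0; have := expfz_neq0 z q0.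
move: (q ^ x) (q ^ y) (q ^ z) => X Y Z Z0 Y0 X0; field.
by rewrite Z0 Y0 X0.
Qed.

Lemma qfactS n : qfact q n.+1 = qfact q n * qint q n.+1%:Z.
Proof. by rewrite /qfact big_nat_recr. Qed.

Lemma qfact_neq0 n : qfact q n != 0.
Proof.
elim: n => [|n IHn]; first by rewrite /qfact big_nil oner_neq0.
by rewrite qfactS mulf_neq0.
Qed.

Lemma qbinom_small (p k : int) : p < k -> qbinom q p k = 0.
Proof. by move=> pk; rewrite /qbinom ifT //; lia. Qed.

Lemma qbinom_neg (p k : int) : k < 0 -> qbinom q p k = 0.
Proof. by move=> k0; rewrite /qbinom k0. Qed.

Lemma qbinom_nat (d k : nat) :
  qbinom q (d + k)%:Z k%:Z = qfact q (d + k) / (qfact q k * qfact q d).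
Proof.
have dk : (d + k)%N%:Z - k%:Z = d%:Z by rewrite PoszD addrK.
by rewrite /qbinom dk /=.
Qed.

Lemma qbinom0 p : qbinom q p 0 = (0 <= p)%R%:R.
Proof.
case: p => p; last by rewrite qbinom_small.
have := qbinom_nat p 0; rewrite addn0 => ->.
by rewrite {2}/qfact big_nil mul1r divff // qfact_neq0.
Qed.

Lemma qbinomSS (p : int) (k : nat) :
  qint q k.+1%:Z * qbinom q (p + 1) k.+1%:Z = qint q (p + 1) * qbinom q p k%:Z.
Proof.
have [pk|kp] := ltP p k%:Z.
  by rewrite !qbinom_small ?mulr0 //; lia.
have -> : p = (`|p - k%:Z|%N + k)%N%:Z by lia.
move: `|_|%N => d.
have -> : (d + k)%N%:Z + 1 = (d + k.+1)%N%:Z by lia.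
rewrite !qbinom_nat addnS !qfactS; field.
by rewrite !qfact_neq0 qint_neq0.
Qed.

Lemma qbinomSr (p : int) (k : nat) :
  qint q k.+1%:Z * qbinom q p k.+1%:Z = qint q (p - k%:Z) * qbinom q p k%:Z.
Proof.
have [pk|kp] := ltP p k%:Z.
  by rewrite !qbinom_small ?mulr0 //; lia.
have -> : p = (`|p - k%:Z|%N + k)%N%:Z by lia.
(* At p = k the left binomial vanishes by its range, the right side by [0] = 0. *)
case: `|_|%N => [|d].
  by rewrite add0n subrr qint0 mul0r qbinom_small ?mulr0 //; lia.
rewrite {1}addSnnS !qbinom_nat -addSnnS addSn !qfactS.
have -> : (d + k).+1%:Z - k%:Z = d.+1%:Z by lia.
field.
by rewrite !qfact_neq0 !qint_neq0.
Qed.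

(** * Matrix coefficients of divided powers on the tensor product *)

Section TensorProduct.

Variables s t : nat.

(* With E v_N = [N] v_(N-1) and coproduct E (x) 1 + K (x) E, [lower_coef] is the
   coefficient of v_a (x) v_b in E^(j+k) (v_(a+j) (x) v_(b+k)); with
   F v_N = [s-N] v_(N+1) and coproduct F (x) K^-1 + 1 (x) F, [raise_coef] is the
   coefficient of v_(a+j) (x) v_(b+k) in F^(j+k) (v_a (x) v_b). *)
Definition lower_coef (j k : nat) (a b : int) : F :=
  q ^ (k%:Z * (s%:Z - 2 * a) - j%:Z * k%:Z)
  * qbinom q (a + j%:Z) j%:Z * qbinom q (b + k%:Z) k%:Z.

Definition raise_coef (j k : nat) (a b : int) : F :=
  q ^ (j%:Z * k%:Z - j%:Z * (t%:Z - 2 * b))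
  * qbinom q (s%:Z - a) j%:Z * qbinom q (t%:Z - b) k%:Z.

(** Common skeleton of the one-step recursions below: one binomial changes by an absorption rule
    while the power of q splits. *)
Lemma twisted_stepl (x y u v w : F) (e f g : int) :
  x * u = y * v -> e = f + g ->
  x * (q ^ e * u * w) = q ^ f * y * (q ^ g * v * w).
Proof.
move=> xu ->; rewrite expfzDr ?q_neq0 //.
have -> : x * (q ^ f * q ^ g * u * w) = q ^ f * q ^ g * (x * u) * w by ring.
by rewrite xu; ring.
Qed.

Lemma twisted_stepr (x y u v w : F) (e f g : int) :
  x * u = y * v -> e = f + g ->
  x * (q ^ e * w * u) = q ^ f * y * (q ^ g * w * v).
Proof.
by move=> xu efg; rewrite mulrAC [q ^ g * w * v]mulrAC; apply: twisted_stepl.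
Qed.

(** Naming of the eight recursions: [first] or [last] tells when the isolated E or F acts, and the
    final [l] or [r] on which tensor factor. *)
Lemma lower_coef_firstl (j k : nat) (a b : int) :
  qint q j.+1%:Z * lower_coef j.+1 k a b =
  q ^ (- k%:Z) * qint q (a + j%:Z + 1) * lower_coef j k a b.
Proof.
apply: twisted_stepl; last by lia.
by rewrite -qbinomSS; congr (_ * qbinom q _ _); lia.
Qed.

Lemma lower_coef_firstr (j k : nat) (a b : int) :
  qint q k.+1%:Z * lower_coef j k.+1 a b =
  q ^ (s%:Z - 2 * a - j%:Z) * qint q (b + k%:Z + 1) * lower_coef j k a b.
Proof.
apply: twisted_stepr; last by lia.
by rewrite -qbinomSS; congr (_ * qbinom q _ _); lia.
Qed.

Lemma lower_coef_lastl (j k : nat) (a b : int) :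
  qint q j.+1%:Z * lower_coef j.+1 k a b =
  q ^ k%:Z * qint q (a + 1) * lower_coef j k (a + 1) b.
Proof.
apply: twisted_stepl; last by lia.
rewrite (_ : a + j.+1%:Z = a + 1 + j%:Z) ?qbinomSr; last by lia.
by congr (qint q _ * _); lia.
Qed.

Lemma lower_coef_lastr (j k : nat) (a b : int) :
  qint q k.+1%:Z * lower_coef j k.+1 a b =
  q ^ (s%:Z - 2 * a - j%:Z) * qint q (b + 1) * lower_coef j k a (b + 1).
Proof.
apply: twisted_stepr; last by lia.
rewrite (_ : b + k.+1%:Z = b + 1 + k%:Z) ?qbinomSr; last by lia.
by congr (qint q _ * _); lia.
Qed.

Lemma raise_coef_lastl (j k : nat) (a b : int) :
  qint q j.+1%:Z * raise_coef j.+1 k a b =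
  q ^ (k%:Z - t%:Z + 2 * b) * qint q (s%:Z - a - j%:Z) * raise_coef j k a b.
Proof. by apply: twisted_stepl; [exact: qbinomSr | lia]. Qed.

Lemma raise_coef_lastr (j k : nat) (a b : int) :
  qint q k.+1%:Z * raise_coef j k.+1 a b =
  q ^ j%:Z * qint q (t%:Z - b - k%:Z) * raise_coef j k a b.
Proof. by apply: twisted_stepr; [exact: qbinomSr | lia]. Qed.

Lemma raise_coef_firstl (j k : nat) (a b : int) :
  qint q j.+1%:Z * raise_coef j.+1 k (a - 1) b =
  q ^ (k%:Z - t%:Z + 2 * b) * qint q (s%:Z - a + 1) * raise_coef j k a b.
Proof.
apply: twisted_stepl; last by lia.
by rewrite -qbinomSS; congr (_ * qbinom q _ _); lia.
Qed.

Lemma raise_coef_firstr (j k : nat) (a b : int) :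
  qint q k.+1%:Z * raise_coef j k.+1 a (b - 1) =
  q ^ (- j%:Z) * qint q (t%:Z - b + 1) * raise_coef j k a b.
Proof.
apply: twisted_stepr; last by lia.
by rewrite -qbinomSS; congr (_ * qbinom q _ _); lia.
Qed.

(** Scalar content of [E, F^(n+1)] = [H - n] F^(n) on a single module: for V_s at v_x, take y = s -
    x. *)
Lemma qint_commutator (x y : int) (n : nat) :
  qint q (x + n.+1%:Z) * qint q (y - n%:Z) - qint q x * qint q (y + 1) =
  qint q n.+1%:Z * qint q (y - n%:Z - x).
Proof.
by rewrite -[RHS]qint_mulB; congr (_ - _ * qint q _); lia.
Qed.

(* The matrix form of [E, F^(m+1)] = [H - m] F^(m). *)
Lemma raise_coef_commutator (j k : nat) (a b : int) :
  (qint q (a + j%:Z + 1) * raise_coef j.+1 k a b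
   + q ^ (s%:Z - 2 * (a + j%:Z)) * qint q (b + k%:Z + 1)
     * raise_coef j k.+1 a b)
  - (qint q a * raise_coef j.+1 k (a - 1) b
     + q ^ (s%:Z - 2 * a) * qint q b * raise_coef j k.+1 a (b - 1)) =
  qint q (s%:Z + t%:Z - 2 * (a + b) - (j + k)%N%:Z) * raise_coef j k a b.
Proof.
have q0 := q_neq0.
have El : qint q (a + j%:Z + 1) * raise_coef j.+1 k a b
    - qint q a * raise_coef j.+1 k (a - 1) b =
    q ^ (k%:Z - t%:Z + 2 * b) * qint q (s%:Z - a - j%:Z - a)
    * raise_coef j k a b.
  apply: (mulfI (qint_neq0 j)).
  rewrite mulrBr ![qint q j.+1%:Z * (qint q _ * _)]mulrCA.
  rewrite raise_coef_lastl raise_coef_firstl.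
  rewrite [RHS]mulrA [X in _ = X * _]mulrCA -qint_commutator.
  rewrite (_ : a + j%:Z + 1 = a + j.+1%:Z); last by lia.
  ring.
have Er : q ^ (s%:Z - 2 * (a + j%:Z)) * qint q (b + k%:Z + 1)
      * raise_coef j k.+1 a b
    - q ^ (s%:Z - 2 * a) * qint q b * raise_coef j k.+1 a (b - 1) =
    q ^ (s%:Z - a - j%:Z - a) * qint q (t%:Z - b - k%:Z - b)
    * raise_coef j k a b.
  apply: (mulfI (qint_neq0 k)).
  rewrite mulrBr ![qint q k.+1%:Z * (_ * raise_coef _ _.+1 _ _)]mulrCA.
  rewrite raise_coef_lastr raise_coef_firstr.
  rewrite [RHS]mulrA [X in _ = X * _]mulrCA -qint_commutator.
  rewrite (_ : b + k%:Z + 1 = b + k.+1%:Z); last by lia.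
  have -> : q ^ (s%:Z - a - j%:Z - a) = q ^ (s%:Z - 2 * (a + j%:Z)) * q ^ j%:Z.
    by rewrite -expfzDr //; congr (q ^ _); lia.
  have -> : q ^ (s%:Z - 2 * a) =
      q ^ (s%:Z - 2 * (a + j%:Z)) * q ^ j%:Z * q ^ j%:Z.
    by rewrite -!expfzDr //; congr (q ^ _); lia.
  have -> : q ^ (- j%:Z) = (q ^ j%:Z)^-1 by rewrite invr_expz.
  field.
  by rewrite expfz_neq0.
(* The two tensor factors contribute separately; [qintD] adds their weights s - 2a - j and t - 2b -
   k. *)
rewrite opprD addrACA El Er -mulrDl; congr (_ * _).
rewrite (_ : s%:Z + t%:Z - 2 * (a + b) - (j + k)%N%:Z =
  (s%:Z - a - j%:Z - a) + (t%:Z - b - k%:Z - b)) ?qintD; last by lia.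
by congr (q ^ _ * _ + _); lia.
Qed.

(** * The trace in the product basis *)

(** T(m, r), summed over the intermediate vectors v_a (x) v_(r-a) reached by E^(m). Indices r - a
    outside 0..t contribute 0 through the binomials. *)
Definition wtrace (m : nat) (r : int) : F :=
  \sum_(0 <= a < s.+1) \sum_(0 <= j < m.+1)
    lower_coef j (m - j) a%:Z (r - a%:Z) * raise_coef j (m - j) a%:Z (r - a%:Z).

(* E^(m+1) = E^(m) E / [m+1]. *)
Lemma antidiag_first (m : nat) (a b : int) :
  qint q m.+1%:Z * (\sum_(0 <= j < m.+2)
    lower_coef j (m.+1 - j) a b * raise_coef j (m.+1 - j) a b) =
  \sum_(0 <= j < m.+1) lower_coef j (m - j) a b *
    (qint q (a + j%:Z + 1) * raise_coef j.+1 (m - j) a b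
     + q ^ (s%:Z - 2 * (a + j%:Z)) * qint q (b + (m - j)%N%:Z + 1)
       * raise_coef j (m - j).+1 a b).
Proof.
have q0 := q_neq0; rewrite mulr_sumr.
(* With k = m + 1 - j, split [m+1] = q^k [j] + q^(-j) [k]: the first power cancels the q^(-k) of
   [lower_coef_firstl], the second completes the K-weight of v_(a+j). *)
pose f j k : F :=
  q ^ k%:Z * (qint q j%:Z * lower_coef j k a b) * raise_coef j k a b.
pose g j k : F :=
  q ^ (- j%:Z) * (qint q k%:Z * lower_coef j k a b) * raise_coef j k a b.
rewrite (eq_big_nat _ _ (F2 := fun j => f j (m.+1 - j)%N + g j (m.+1 - j)%N)).
  rewrite big_antidiag_shift; last first.
  - by rewrite /g qint0 mul0r mulr0 mul0r.
  - by rewrite /f qint0 mul0r mulr0 mul0r.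
  apply: eq_bigr => j _; rewrite /f /g lower_coef_firstl lower_coef_firstr.
  have -> : q ^ (- (m - j)%N%:Z) = (q ^ (m - j)%N%:Z)^-1 by rewrite invr_expz.
  have -> : q ^ (s%:Z - 2 * (a + j%:Z)) =
      q ^ (- j%:Z) * q ^ (s%:Z - 2 * a - j%:Z).
    by rewrite -expfzDr //; congr (q ^ _); lia.
  by field; rewrite expfz_neq0.
move=> j /andP[_ jm]; rewrite /f /g.
rewrite (_ : m.+1%:Z = (m.+1 - j)%N%:Z + j%:Z) ?qintD; last by lia.
ring.
Qed.

(* E^(m+1) = E E^(m) / [m+1]. *)
Lemma antidiag_last (m : nat) (a b : int) :
  qint q m.+1%:Z * (\sum_(0 <= j < m.+2)
    lower_coef j (m.+1 - j) a b * raise_coef j (m.+1 - j) a b) =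
  \sum_(0 <= j < m.+1) (
    lower_coef j (m - j) (a + 1) b
      * (qint q (a + 1) * raise_coef j.+1 (m - j) a b)
    + lower_coef j (m - j) a (b + 1)
      * (q ^ (s%:Z - 2 * a) * qint q (b + 1) * raise_coef j (m - j).+1 a b)).
Proof.
have q0 := q_neq0; rewrite mulr_sumr.
(* The opposite splitting [m+1] = q^(-k) [j] + q^j [k], which yields the K-weight of v_a instead. *)
pose f j k : F :=
  q ^ (- k%:Z) * (qint q j%:Z * lower_coef j k a b) * raise_coef j k a b.
pose g j k : F :=
  q ^ j%:Z * (qint q k%:Z * lower_coef j k a b) * raise_coef j k a b.
rewrite (eq_big_nat _ _ (F2 := fun j => f j (m.+1 - j)%N + g j (m.+1 - j)%N)).
  rewrite big_antidiag_shift; last first.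
  - by rewrite /g qint0 mul0r mulr0 mul0r.
  - by rewrite /f qint0 mul0r mulr0 mul0r.
  apply: eq_bigr => j _; rewrite /f /g lower_coef_lastl lower_coef_lastr.
  have -> : q ^ (- (m - j)%N%:Z) = (q ^ (m - j)%N%:Z)^-1 by rewrite invr_expz.
  have -> : q ^ (s%:Z - 2 * a) = q ^ j%:Z * q ^ (s%:Z - 2 * a - j%:Z).
    by rewrite -expfzDr //; congr (q ^ _); lia.
  by field; rewrite expfz_neq0.
move=> j /andP[_ jm]; rewrite /f /g.
rewrite (_ : m.+1%:Z = j%:Z + (m.+1 - j)%N%:Z) ?qintD; last by lia.
ring.
Qed.

Lemma wtrace_first (m : nat) (r : int) :
  qint q m.+1%:Z * wtrace m.+1 r =
  \sum_(0 <= a < s.+1) \sum_(0 <= j < m.+1)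
    lower_coef j (m - j) a%:Z (r - a%:Z) *
    (qint q (a%:Z + j%:Z + 1) * raise_coef j.+1 (m - j) a%:Z (r - a%:Z)
     + q ^ (s%:Z - 2 * (a%:Z + j%:Z)) * qint q (r - a%:Z + (m - j)%N%:Z + 1)
       * raise_coef j (m - j).+1 a%:Z (r - a%:Z)).
Proof.
by rewrite /wtrace mulr_sumr; apply: eq_bigr => a _; exact: antidiag_first.
Qed.

Lemma wtrace_last (m : nat) (r : int) :
  qint q m.+1%:Z * wtrace m.+1 (r - 1) =
  \sum_(0 <= a < s.+1) \sum_(0 <= j < m.+1)
    lower_coef j (m - j) a%:Z (r - a%:Z) *
    (qint q a%:Z * raise_coef j.+1 (m - j) (a%:Z - 1) (r - a%:Z)
     + q ^ (s%:Z - 2 * a%:Z) * qint q (r - a%:Z)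
       * raise_coef j (m - j).+1 a%:Z (r - a%:Z - 1)).
Proof.
pose h (a : nat) : F := \sum_(0 <= j < m.+1)
  lower_coef j (m - j) a%:Z (r - a%:Z)
  * (qint q a%:Z * raise_coef j.+1 (m - j) (a%:Z - 1) (r - a%:Z)).
have h0 : h 0%N = 0.
  by apply: big1 => j _; rewrite qint0 mul0r mulr0.
have hS : h s.+1 = 0.
  apply: big1 => j _; rewrite /raise_coef.
  rewrite [qbinom q (s%:Z - _) _]qbinom_small; last by lia.
  by rewrite mulr0 mul0r !mulr0.
(* Cyclicity of the trace: the left-factor terms move from a to a + 1. The ends vanish by [0] = 0 at
   a = 0 and by a binomial with top 0 and bottom j + 1 at a = s + 1. *)
have h_shift : \sum_(0 <= a < s.+1) h a.+1 = \sum_(0 <= a < s.+1) h a.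
  apply: (addrI (h 0%N)).
  by rewrite -big_nat_recl // big_nat_recr //= hS h0 addr0 add0r.
under [RHS]eq_bigr => a _ do under eq_bigr => j _ do rewrite mulrDr.
under [RHS]eq_bigr => a _ do rewrite big_split /=.
rewrite big_split /= -/(h _) -h_shift -big_split /= /wtrace mulr_sumr.
apply: eq_bigr => a _; rewrite antidiag_last big_split /=.
have -> : r - 1 - a%:Z = r - a.+1%:Z by lia.
have -> : a%:Z + 1 = a.+1%:Z by lia.
have -> : r - a.+1%:Z + 1 = r - a%:Z by lia.
rewrite /h; have -> : a.+1%:Z - 1 = a%:Z by lia.
by have -> : r - a%:Z - 1 = r - a.+1%:Z by lia.
Qed.

Lemma wtrace_rec (m : nat) (r : int) :
  qint q m.+1%:Z * (wtrace m.+1 r - wtrace m.+1 (r - 1)) =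
  qint q (s%:Z + t%:Z - 2 * r - m%:Z) * wtrace m r.
Proof.
rewrite mulrBr wtrace_first wtrace_last -sumrB /wtrace mulr_sumr.
apply: eq_bigr => a _; rewrite -sumrB mulr_sumr.
apply: eq_big_nat => j /andP[_ jm].
rewrite -mulrBr raise_coef_commutator subnKC // mulrCA.
by rewrite (_ : a%:Z + (r - a%:Z) = r) // addrC subrK.
Qed.

Lemma wtrace_neg (m : nat) : wtrace m (- 1) = 0.
Proof.
apply: big1 => a _; apply: big1 => j _; rewrite /lower_coef.
by rewrite [qbinom q (- 1 - _ + _) _]qbinom_small ?mulr0 ?mul0r //; lia.
Qed.

(** * The Clebsch-Gordan side and the comparison *)

(* The l-th term is the eigenvalue of F^(m) E^(m) on the summand V_(s+t-2l). *)
Definition cgtrace (m : nat) (r : int) : F :=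
  \sum_(0 <= l < (minn s t).+1)
    qbinom q (r + m%:Z - l%:Z) m%:Z * qbinom q (s%:Z + t%:Z - l%:Z - r) m%:Z.

(** Absorption reduces both products on the left to the one on the right, leaving [x+m+1][y] -
    [x][y+m+1] = [m+1][y-x]. *)
Lemma qbinom_mul_rec (x y : int) (m : nat) :
  qint q m.+1%:Z
  * (qbinom q (x + m%:Z + 1) m.+1%:Z * qbinom q (y + m%:Z) m.+1%:Z
     - qbinom q (x + m%:Z) m.+1%:Z * qbinom q (y + m%:Z + 1) m.+1%:Z) =
  qint q (y - x) * (qbinom q (x + m%:Z) m%:Z * qbinom q (y + m%:Z) m%:Z).
Proof.
apply: (mulfI (qint_neq0 m)).
have [Xs Xr] := (qbinomSS (x + m%:Z) m, qbinomSr (x + m%:Z) m).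
have [Ys Yr] := (qbinomSS (y + m%:Z) m, qbinomSr (y + m%:Z) m).
move: Xr Yr; rewrite !addrK => Xr Yr.
have H := qint_mulB x y m.+1%:Z.
transitivity (
  (qint q m.+1%:Z * qbinom q (x + m%:Z + 1) m.+1%:Z)
  * (qint q m.+1%:Z * qbinom q (y + m%:Z) m.+1%:Z)
  - (qint q m.+1%:Z * qbinom q (x + m%:Z) m.+1%:Z)
  * (qint q m.+1%:Z * qbinom q (y + m%:Z + 1) m.+1%:Z)); first by ring.
rewrite Xs Xr Ys Yr [RHS]mulrA -H.
rewrite (_ : x + m%:Z + 1 = x + m.+1%:Z); last by lia.
rewrite (_ : y + m%:Z + 1 = y + m.+1%:Z); last by lia.
ring.
Qed.

Lemma cgtrace_rec (m : nat) (r : int) :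
  qint q m.+1%:Z * (cgtrace m.+1 r - cgtrace m.+1 (r - 1)) =
  qint q (s%:Z + t%:Z - 2 * r - m%:Z) * cgtrace m r.
Proof.
rewrite -sumrB !mulr_sumr; apply: eq_bigr => l _.
(* The recursion holds termwise: with these arguments y - x = s + t - 2r - m is free of l. *)
have := qbinom_mul_rec (r - l%:Z) (s%:Z + t%:Z - l%:Z - r - m%:Z) m.
rewrite (_ : s%:Z + t%:Z - l%:Z - r - m%:Z - (r - l%:Z) =
  s%:Z + t%:Z - 2 * r - m%:Z); last by lia.
rewrite subrK (_ : r - l%:Z + m%:Z = r + m%:Z - l%:Z); last by lia.
move=> <-; congr (_ * (qbinom q _ _ * _ - qbinom q _ _ * qbinom q _ _)); lia.
Qed.

Lemma cgtrace_neg (m : nat) : cgtrace m (- 1) = 0.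
Proof. by apply: big1 => l _; rewrite qbinom_small ?mul0r //; lia. Qed.

(** Every summand is 0 or 1, so both sides count integers in an interval: max(0, r-t) <= a <= min(s,
    r) and 0 <= l <= min(s, t, r, s+t-r). *)
Lemma wtrace0 (r : nat) : wtrace 0 r%:Z = cgtrace 0 r%:Z.
Proof.
have count_interval (N lo hi : nat) :
    (\sum_(0 <= a < N) ((lo <= a) && (a < hi)))%N = (minn N hi - lo)%N.
  by elim: N => [|N IHN]; rewrite ?big_nil ?big_nat_recr //= ?IHN; lia.
have -> : wtrace 0 r%:Z =
    (\sum_(0 <= a < s.+1) ((r - t <= a) && (a < r.+1))%N)%:R.
  rewrite natr_sum; apply: eq_big_nat => a /andP[_ a_s].
  rewrite big_nat1 /lower_coef /raise_coef !mul0r !subr0 expr0z !mul1r.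
  rewrite !qbinom0 -!natrM !mulnb; congr (nat_of_bool _)%:R; lia.
have -> : cgtrace 0 r%:Z = (\sum_(0 <= l < (minn s t).+1)
    ((0 <= l) && (l < minn r.+1 ((s + t).+1 - r)))%N)%:R.
  rewrite natr_sum; apply: eq_big_nat => l /andP[_ l_st].
  rewrite !qbinom0 -natrM mulnb; congr (nat_of_bool _)%:R; lia.
by rewrite !count_interval; congr (_%:R); lia.
Qed.

(** Induction on m, then on r starting from r = -1, where both sides vanish; the recursion fixes the
    increments in r because [m+1] is nonzero. *)
Lemma wtraceE (m r : nat) : wtrace m r%:Z = cgtrace m r%:Z.
Proof.
elim: m r => [|m IHm] r; first exact: wtrace0.
have step (n : nat) : wtrace m.+1 (n%:Z - 1) = cgtrace m.+1 (n%:Z - 1) ->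
    wtrace m.+1 n%:Z = cgtrace m.+1 n%:Z.
  move=> E; have : qint q m.+1%:Z * (wtrace m.+1 n%:Z - wtrace m.+1 (n%:Z - 1))
      = qint q m.+1%:Z * (cgtrace m.+1 n%:Z - cgtrace m.+1 (n%:Z - 1)).
    by rewrite wtrace_rec cgtrace_rec IHm.
  by move/(mulfI (qint_neq0 m)); rewrite E => /addIr.
elim: r => [|r IHr]; apply: step; first by rewrite sub0r wtrace_neg cgtrace_neg.
by rewrite (_ : r.+1%:Z - 1 = r%:Z) //; lia.
Qed.

End TensorProduct.

(** * Translation to the double sum over integers *)

Lemma qbinom_clebsch_gordan (s t n m : nat) : (m <= n)%N ->
  \sum_(j \in [set: int]) \sum_(i \in [set: int])
     q ^ (2 * m%:Z * i + j * (2 * n%:Z - s%:Z - t%:Z) + m%:Z * s%:Z)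
     * qbinom q (n%:Z - i) j
     * qbinom q i (m%:Z - j)
     * qbinom q (i + j + s%:Z - n%:Z) j
     * qbinom q (m%:Z - i - j + t%:Z) (m%:Z - j)
  = q ^ (2 * m%:Z * n%:Z)
    * \sum_(l \in [set l : int | (0 <= l) && (l <= Num.min s%:Z t%:Z)])
        qbinom q (n%:Z - l) m%:Z
        * qbinom q (m%:Z + s%:Z + t%:Z - l - n%:Z) m%:Z.
Proof.
move=> mn; have q0 := q_neq0.
rewrite [in RHS](fsum_int_nat _ _ _ Posz (minn s t).+1) /=; first last.
- by move=> x /andP[x0 xst] xN; case: (xN `|x|%N); lia.
- by move=> a a_st; lia.
- by move=> x y [].
rewrite (fsum_int_nat _ _ _ Posz m.+1) //=; first last.
- move=> j _ jN; apply: fsbig1 => i _.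
  have [j0|j0] := ltP j 0.
    by rewrite (qbinom_neg (_ - i)) // ?(mulr0, mul0r).
  rewrite (qbinom_neg i) ?(mulr0, mul0r) //.
  by have := jN `|j|%N; lia.
- by move=> x y [].
have -> : \sum_(0 <= l < (minn s t).+1)
    qbinom q (n%:Z - l%:Z) m%:Z
    * qbinom q (m%:Z + s%:Z + t%:Z - l%:Z - n%:Z) m%:Z =
    cgtrace s t m (n - m)%N%:Z.
  by apply: eq_bigr => l _; congr (qbinom _ _ _ * qbinom _ _ _); lia.
rewrite -wtraceE /wtrace exchange_big_nat mulr_sumr /=.
apply: eq_big_nat => j /andP[_ jm].
(* Substitute i = n - j - a. The first binomial vanishes for a < 0, the third for a > s. *)
rewrite (fsum_int_nat _ _ _ (fun a : nat => n%:Z - j%:Z - a%:Z) s.+1) //=;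
  first last.
- move=> i _ iN; have [ij|ij] := ltP (n%:Z - i) j%:Z.
    by rewrite (qbinom_small (_ - i)) // ?(mulr0, mul0r).
  rewrite (qbinom_small (i + _ + _ - _)) ?(mulr0, mul0r) //.
  have [//|si] := ltP (i + j%:Z + s%:Z - n%:Z) j%:Z.
  by case: (iN (absz (n%:Z - j%:Z - i)%R)); lia.
- by move=> x y; lia.
rewrite mulr_sumr; apply: eq_bigr => a _; rewrite /lower_coef /raise_coef.
have -> : n%:Z - (n%:Z - j%:Z - a%:Z) = a%:Z + j%:Z by lia.
have -> : (n - m)%N%:Z - a%:Z + (m - j)%N%:Z = n%:Z - j%:Z - a%:Z by lia.
have -> : n%:Z - j%:Z - a%:Z + j%:Z + s%:Z - n%:Z = s%:Z - a%:Z by lia.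
have -> : m%:Z - (n%:Z - j%:Z - a%:Z) - j%:Z + t%:Z =
  t%:Z - ((n - m)%N%:Z - a%:Z) by lia.
have -> : m%:Z - j%:Z = (m - j)%N%:Z by lia.
set c := qbinom q (a%:Z + _) _; set d := qbinom q (_ - a%:Z) (m - j)%N%:Z.
set c' := qbinom q (_ - a%:Z) j%:Z; set d' := qbinom q _ (m - j)%N%:Z.
set e := (X in q ^ X * _ * _ * _ * _ = _).
(* The exponent splits into the prefactor of the right-hand side and the exponents of [lower_coef]
   and [raise_coef]. *)
have -> : e = 2 * m%:Z * n%:Z
    + ((m - j)%N%:Z * (s%:Z - 2 * a%:Z) - j%:Z * (m - j)%N%:Z)
    + (j%:Z * (m - j)%N%:Z - j%:Z * (t%:Z - 2 * ((n - m)%N%:Z - a%:Z))).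
  rewrite /e -!subzn //; ring.
by rewrite !expfzDr //; ring.
Qed.

End QIdentities.

(** * Specialization to the indeterminate *)

(** If q^n = q^(-n), then q^(2n) = 1; this handles the numerator of [k+1] and, with n = 1, its
    denominator. *)
Lemma qint_neq0_of_expr_neq1 (F : fieldType) (q : F) :
  q != 0 -> (forall n : nat, (0 < n)%N -> q ^+ n != 1) ->
  forall k : nat, qint q k.+1%:Z != 0.
Proof.
move=> q0 q1 k.
have qd (n : nat) : (0 < n)%N -> q ^+ n - (q ^+ n)^-1 != 0.
  move=> n0; rewrite subr_eq0; apply: contra (q1 (n + n)%N _); last by lia.
  by move=> /eqP E; rewrite exprD {1}E mulVf // expf_neq0.
by rewrite /qint -invr_expz mulf_neq0 ?invr_neq0 ?qd ?(qd 1%N).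
Qed.

Lemma qint_qvar_neq0 (k : nat) : qint qvar k.+1%:Z != 0.
Proof.
apply: qint_neq0_of_expr_neq1 => [|n n0].
  by rewrite tofrac_eq0 polyX_eq0.
rewrite /qvar -rmorphXn -(rmorph1 (@FracField.tofrac _)) tofrac_eq.
apply/eqP => /(congr1 (fun p : {poly rat} => size p)) /eqP.
by rewrite size_polyXn size_poly1 eqSS; case: n n0.
Qed.

Theorem corollary1p6 (s s' n m : int)
    (hs : 0 <= s) (hs' : 0 <= s') (hn : n <= s + s') (hmn : m <= n)
    (hm : 0 <= m) :
  \sum_(j \in [set: int]) \sum_(i \in [set: int])
     qvar ^ (2 * m * i + j * (2 * n - s - s') + m * s)
     * qbinom qvar (n - i) j
     * qbinom qvar i (m - j)
     * qbinom qvar (i + j + s - n) j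
     * qbinom qvar (m - i - j + s') (m - j)
  = qvar ^ (2 * m * n)
    * \sum_(l \in [set l : int | (0 <= l) && (l <= Num.min s s')])
        qbinom qvar (n - l) m
        * qbinom qvar (m + s + s' - l - n) m.
Proof.
case: s hs hn => [s _|//]; case: s' hs' => [t _|//] hn.
case: m hm hmn => [m _|//]; case: n hn => [n hn|//] hmn.
exact: (qbinom_clebsch_gordan _ _ qint_qvar_neq0).
Qed.
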